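(* Let $n\ge 1$, let $A,B$ be real symmetric $n\times n$ matrices, $a,b\in\mathbb{R}^n$, $f(x)=\langle Ax,x\rangle+\langle a,x\rangle$, $g(x)=\langle Bx,x\rangle+\langle b,x\rangle$ and $F(x)=(f(x),g(x))$ for $x\in\mathbb{R}^n$. If $F(\mathbb{R}^n)+\mathbb{R}_+d$ is convex for all $d\in\mathbb{R}^2$, $d\neq 0$, then $F(\mathbb{R}^n)$ is convex.
   Context: $\mathbb{R}_+=[0,+\infty[$ and $\mathbb{R}_+d=\{td: t\ge 0\}$. *)

(* Defs.v *)
From HB Require Import structures.
From mathcomp Require Import all_boot all_order all_algebra.
From mathcomp Require Import classical_sets reals convex.

Set Implicit Arguments.
Unset Strict Implicit.
Unset Printing Implicit Defensive.

Import Order.TTheory GRing.Theory Num.Theory.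

Local Open Scope classical_set_scope.
Local Open Scope ring_scope.

Definition dotp (R : realType) (n : nat) (u v : 'cV[R]_n) : R :=
  \sum_(i < n) u i 0 * v i 0.

Definition quad (R : realType) (n : nat) (A : 'M[R]_n) (a x : 'cV[R]_n) : R :=
  dotp (A *m x) x + dotp a x.

(* The regular module R^o makes the plane an R-vector space, as needed for *:
   and convex_set. *)
Notation plane R := (R^o * R^o)%type.

Definition ray (R : realType) (d : plane R) : set (plane R) :=
  [set t *: d | t in [set t : R | 0 <= t]].

Definition set_sum (R : realType) (X Y : set (plane R)) : set (plane R) :=
  [set p + q | p in X & q in Y].

(* Main.v *)
(* Suppose a point m of a segment joining two values of F is not a value, and
   put G = F - m. Convexity of F(R^n) + R_+ (- d) shows that G meets every open
   ray from 0. For d <> 0 take x with G x on the ray of d and y with G y on the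
   ray of - d: the image of [x, y] is an arc of a parabola passing 0 on the left
   or on the right. The side is read off the sign at the midpoint of the
   quadratic function q = det(d, G), since q vanishes at x and y. It does not
   depend on x and y: otherwise the conic q = 0 in a plane would contain an arc
   along which <d, G> changes sign, hence a zero of G. It is locally constant in
   d: q takes both signs, so the quadratic q has no local extremum on q = 0, and
   x and y can be perturbed along with d. But replacing d by - d reverses the
   side, which contradicts the connectedness of the set of directions. *)
Require Import Defs.
From HB Require Import structures.
From mathcomp Require Import all_boot all_order all_algebra.
From mathcomp Require Import ring lra.
From mathcomp Require Import boolp classical_sets reals.
From mathcomp Require Import topology normedtype convex.

Set Implicit Arguments.
Unset Strict Implicit.
Unset Printing Implicit Defensive.

Import Order.TTheory GRing.Theory Num.Theory.
Import numFieldNormedType.Exports.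

Local Open Scope classical_set_scope.
Local Open Scope ring_scope.

(** * Sign changes of polynomials and along arcs of conics *)

Lemma poly_root_between (R : realType) (p : {poly R}) :
  0 < p.[0] -> p.[1] < 0 -> exists2 t, 0 <= t <= 1 & p.[t] = 0.
Proof.
move=> p0 p1; have [||t t01 /rootP pt] := @poly_ivt R (- p) 0 1.
  exact: ler01.
  by rewrite !hornerN oppr_le0 oppr_ge0 !ltW.
by exists t => //; apply/eqP; rewrite -oppr_eq0 -hornerN pt.
Qed.

(* The conic passes through (0, 0), (1, 0) and (0, 1), and its second condition
   is the vanishing of a quadratic function of (s, t) of opposite signs at (0, 0)
   and (0, 1); the two points are joined by an arc of the conic. *)
Lemma conic_arc_sign_change (R : realType) (a b e h0 m1 m2 n11 n12 n22 : R) :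
  0 < a -> 0 < b -> 0 < e -> 0 < h0 -> h0 + m2 + n22 < 0 ->
  exists s t : R,
    s * a - t * b - s ^+ 2 * a + s * t * (e - a + b) + t ^+ 2 * b = 0 /\
    h0 + s * m1 + t * m2 + s ^+ 2 * n11 + s * t * n12 + t ^+ 2 * n22 = 0.
Proof.
move=> a0 b0 e0 h00 h1.
(* each line from (1, 0) to (0, r), 0 <= r <= 1, meets the conic at a second
   point ((b r (1 - r)) / D, r (a (1 - r) + e r) / D) *)
pose q r := a * (1 - r) + e * r + b * r * (1 - r).
pose Y : {poly R} := 1%:P - 'X.
pose U := b%:P * 'X * Y.
pose W := 'X * (a%:P * Y + e%:P * 'X).
pose D := a%:P * Y + e%:P * 'X + b%:P * 'X * Y.
pose P := h0%:P * D ^+ 2 + m1%:P * U * D + m2%:P * W * D + n11%:P * U ^+ 2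
  + n12%:P * U * W + n22%:P * W ^+ 2.
have PE r : P.[r] = h0 * q r ^+ 2 + m1 * (b * r * (1 - r)) * q r
    + m2 * (r * (a * (1 - r) + e * r)) * q r + n11 * (b * r * (1 - r)) ^+ 2
    + n12 * (b * r * (1 - r)) * (r * (a * (1 - r) + e * r))
    + n22 * (r * (a * (1 - r) + e * r)) ^+ 2.
  by rewrite !(hornerD, hornerN, hornerM, hornerC, hornerX, horner_exp).
have [||r /andP[r0 r1]] := @poly_root_between R P.
- by rewrite PE /q (_ : _ + _ = h0 * a ^+ 2) ?mulr_gt0 ?exprn_gt0 //; ring.
- rewrite PE /q (_ : _ + _ = (h0 + m2 + n22) * e ^+ 2); last by ring.
  by rewrite nmulr_rlt0 // exprn_gt0.
rewrite PE => H.
set d := q r in H.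
have d0 : 0 < d.
  have : 0 <= b * r * (1 - r) by rewrite !mulr_ge0 // ?subr_ge0 // ltW.
  suff : 0 < a * (1 - r) + e * r by rewrite /d /q; lra.
  case: (ltP 0 r) => [r0'|r0'].
    by rewrite ltr_wpDl // ?mulr_gt0 // mulr_ge0 ?subr_ge0 // ltW.
  have -> : r = 0 by apply/eqP; rewrite eq_le r0 r0'.
  lra.
have dn0 : d != 0 by rewrite gt_eqF.
exists (b * r * (1 - r) / d), (r * (a * (1 - r) + e * r) / d); split.
  by rewrite /d /q; field.
apply: (mulIf (expf_neq0 2 dn0)); rewrite mul0r -[RHS]H.
by field.
Qed.

(** * Quadratic functions on a vector space *)

(** Restrictions to planes suffice, since at most three points are compared at a time. *)
Definition quadratic (R : realType) (V : lmodType R) (f : V -> R) :=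
  forall x u w, exists l1 l2 q11 q12 q22 : R, forall s t,
    f (x + s *: u + t *: w) =
      f x + s * l1 + t * l2 + s ^+ 2 * q11 + s * t * q12 + t ^+ 2 * q22.

Definition midpoint (R : realType) (V : lmodType R) (x y : V) : V :=
  2^-1 *: (x + y).

Lemma midpointC (R : realType) (V : lmodType R) (x y : V) :
  midpoint x y = midpoint y x.
Proof. by rewrite /midpoint addrC. Qed.

Lemma midpointE (R : realType) (V : lmodType R) (x y : V) :
  midpoint x y = x + 2^-1 *: (y - x).
Proof.
rewrite /midpoint scalerDr scalerBr addrCA addrC; congr (_ + _).
by rewrite -[X in X - _]scale1r -scalerBl; congr (_ *: _); field.
Qed.

Lemma quadratic_line (R : realType) (V : lmodType R) (f : V -> R) (x u : V) :
  quadratic f ->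
  exists l q : R, forall t, f (x + t *: u) = f x + t * l + t ^+ 2 * q.
Proof.
move=> /(_ x u 0)[l [l2 [q [q12 [q22 E]]]]]; exists l, q => t.
by have := E t 0; rewrite scale0r addr0 => ->; ring.
Qed.

Lemma quadratic_lin_comb (R : realType) (V : lmodType R) (f g : V -> R)
    (c d : R) :
  quadratic f -> quadratic g -> quadratic (fun x => c * f x + d * g x).
Proof.
move=> qf qg x u w.
have [l1 [l2 [q11 [q12 [q22 Ef]]]]] := qf x u w.
have [m1 [m2 [n11 [n12 [n22 Eg]]]]] := qg x u w.
exists (c * l1 + d * m1), (c * l2 + d * m2), (c * q11 + d * n11),
  (c * q12 + d * n12), (c * q22 + d * n22) => s t.
by rewrite Ef Eg; ring.
Qed.

Lemma quadratic_root_between (R : realType) (V : lmodType R) (f : V -> R)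
    (x y : V) : quadratic f -> 0 < f x -> f y < 0 ->
  exists2 t, 0 <= t <= 1 & f (x + t *: (y - x)) = 0.
Proof.
move=> qf fx fy; have [l [q E]] := quadratic_line x (y - x) qf.
pose P : {poly R} := (f x)%:P + 'X * l%:P + 'X ^+ 2 * q%:P.
have PE t : P.[t] = f (x + t *: (y - x)).
  by rewrite E !(hornerD, hornerM, hornerC, hornerX, horner_exp).
have [||t t01 Pt] := @poly_root_between R P.
- by rewrite PE scale0r addr0.
- by rewrite PE scale1r addrC subrK.
by exists t => //; rewrite -PE.
Qed.

Lemma plane_segment (R : realType) (V : lmodType R) (x u w : V)
    (s t s' t' r : R) :
  x + s *: u + t *: w + r *: ((x + s' *: u + t' *: w) - (x + s *: u + t *: w))
  = x + (s + r * (s' - s)) *: u + (t + r * (t' - t)) *: w.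
Proof.
have -> : x + s' *: u + t' *: w - (x + s *: u + t *: w) =
    (s' - s) *: u + (t' - t) *: w.
  rewrite !opprD addrACA !scalerBl; congr (_ + _).
  by rewrite addrACA subrr add0r.
by rewrite scalerDr !scalerA addrACA -[X in X + _]addrA -!scalerDl.
Qed.

(** In the plane of [x], [y], [z], the zero set of [f] is a conic through the three points. Its part
    joining [x] to [y] or to [z] carries a sign change of [h], hence a common zero. *)
Lemma midpoint_sign_unique (R : realType) (V : lmodType R) (f h : V -> R)
    (x y z : V) : quadratic f -> quadratic h ->
  (forall v, f v = 0 -> h v != 0) ->
  f x = 0 -> f y = 0 -> f z = 0 -> 0 < h x -> h y < 0 -> h z < 0 ->
  0 < f (midpoint x y) -> f (midpoint x z) < 0 -> False.
Proof.
move=> qf qh nz fx fy fz hx hy hz.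
have [l1 [l2 [q11 [q12 [q22 Ef]]]]] := qf x (y - x) (z - x).
have [m1 [m2 [n11 [n12 [n22 Eh]]]]] := qh x (y - x) (z - x).
pose pt s t := x + s *: (y - x) + t *: (z - x).
have xE : x = pt 0 0 by rewrite /pt !scale0r !addr0.
have yE : y = pt 1 0 by rewrite /pt scale0r addr0 scale1r addrC subrK.
have zE : z = pt 0 1 by rewrite /pt scale0r addr0 scale1r addrC subrK.
have midy : midpoint x y = pt 2^-1 0 by rewrite midpointE /pt scale0r addr0.
have midz : midpoint x z = pt 0 2^-1 by rewrite midpointE /pt scale0r addr0.
rewrite midy midz [in X in X -> _]/pt [in X in _ -> X -> _]/pt !Ef.
move: fy fz hy hz; rewrite yE zE /pt !Ef !Eh fx => fy fz hy hz fmy fmz.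
(* The zeros at [y] and [z] fix the square coefficients; the midpoint values become [l1 / 4] and
   [l2 / 4]. *)
have q11E : q11 = - l1 by lra.
have q22E : q22 = - l2 by lra.
subst q11 q22.
have a0 : 0 < l1 by lra.
have b0 : 0 < - l2 by lra.
have none s t : f (pt s t) = 0 -> h (pt s t) = 0 -> False.
  by move=> /nz /eqP.
have segment s t s' t' : (forall r, 0 <= r <= 1 ->
    f (pt (s + r * (s' - s)) (t + r * (t' - t))) = 0) ->
    0 < h (pt s t) -> 0 <= h (pt s' t').
  move=> f0 hs; rewrite leNgt; apply/negP => hs'.
  have [r r01] := quadratic_root_between qh hs hs'.
  by rewrite /pt plane_segment; apply: none; exact: f0.
(* This is the parameter [e] of [conic_arc_sign_change]. If it is positive, the arc joins [x] to
   [z]; if negative, negating [f] and exchanging [s] and [t] gives an arc from [x] to [y]. *)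
have [e0|e0|e0] := ltrgtP 0 (l1 + l2 + q12).
- have [|s [t [f0 h0]]] :=
    @conic_arc_sign_change R l1 (- l2) _ (h x) m1 m2 n11 n12 n22 a0 b0 e0 hx.
    by lra.
  by apply: (none s t); rewrite /pt ?Ef ?Eh // fx -[RHS]f0; ring.
- have e0' : 0 < - (l1 + l2 + q12) by lra.
  have [|t [s [f0 h0]]] :=
    @conic_arc_sign_change R (- l2) l1 _ (h x) m2 m1 n22 n12 n11 b0 a0 e0' hx.
    by lra.
  apply: (none s t); rewrite /pt ?Ef ?Eh.
    by rewrite fx; lra.
  by rewrite -[RHS]h0; ring.
(* the conic is the union of the lines a s = b t and s + t = 1 *)
have q12E : q12 = - l1 - l2 by lra.
subst q12.
have dn0 : l1 - l2 != 0 by rewrite gt_eqF //; lra.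
(* The two lines cross at [(s0, t0)]; the sign of [h] is carried from [x] to this point and then to
   [y]. *)
pose s0 := - l2 / (l1 - l2); pose t0 := l1 / (l1 - l2).
have h0 : 0 <= h (pt s0 t0).
  apply: (segment 0 0); last by rewrite -xE.
  by move=> r _; rewrite /pt Ef fx /s0 /t0; field.
have {}h0 : 0 < h (pt s0 t0).
  rewrite lt_neqAle h0 andbT eq_sym; apply: nz.
  by rewrite /pt Ef fx /s0 /t0; field.
have : 0 <= h (pt 1 0).
  by apply: (segment _ _ _ _ _ h0) => r _; rewrite /pt Ef fx /s0 /t0; field.
by rewrite /pt Eh; lra.
Qed.

(** A third zero at the midpoint would make [f] vanish on the whole line, where [h] changes sign. *)
Lemma quadratic_midpoint_neq0 (R : realType) (V : lmodType R) (f h : V -> R)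
    (x y : V) : quadratic f -> quadratic h ->
  (forall v, f v = 0 -> h v != 0) ->
  f x = 0 -> f y = 0 -> 0 < h x -> h y < 0 -> f (midpoint x y) != 0.
Proof.
move=> qf qh nz fx fy hx hy; apply/eqP; rewrite midpointE.
have [l [q E]] := quadratic_line x (y - x) qf.
have E1 : f y = f x + 1 * l + 1 ^+ 2 * q.
  by rewrite -E scale1r addrC subrK.
have [t _ ht] := quadratic_root_between qh hx hy.
rewrite E => E2; suff /nz : f (x + t *: (y - x)) = 0 by rewrite ht eqxx.
have q0 : q = 0 by lra.
have l0 : l = 0 by lra.
by rewrite E fx q0 l0; ring.
Qed.

(** * Zeros of quadratic functions under perturbation *)

(** On the line to [p], [f] is [t * l + t ^+ 2 * q] with [l + q > 0]: small [t] of the same sign as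
    [l] give positive values. *)
Lemma quadratic_pos_near (R : realType) (V : normedModType R) (f : V -> R)
    (x p : V) (U : set V) :
  quadratic f -> f x = 0 -> 0 < f p -> nbhs x U -> exists2 z, U z & 0 < f z.
Proof.
move=> qf fx fp Ux; have [l [q E]] := quadratic_line x (p - x) qf.
have fpE : f p = l + q.
  have := E 1; rewrite scale1r addrC subrK fx => ->; ring.
have : \forall t \near (0 : R), U (x + t *: (p - x)).
  have c : (fun t : R => x + t *: (p - x)) @ (0 : R) --> x + (0 : R) *: (p - x).
    apply: cvgD; first exact: cvg_cst.
    by apply: cvgZ; [exact: cvg_id|exact: cvg_cst].
  by apply: c; rewrite scale0r addr0.
case/nbhs_ballP => r /= r0 rU.
pose t := Num.min 1 (r / 2).
have t0 : 0 < t by rewrite lt_min ltr01 divr_gt0.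
have t1 : t <= 1 by rewrite ge_min lexx.
have tr : t < r by rewrite gt_min (_ : r / 2 < r) ?orbT //; lra.
(* The value equals [t * (1 - t) * c + t ^+ 2 * (c + q)]. *)
have pos c : 0 <= c -> 0 < c + q -> 0 < t * c + t ^+ 2 * q.
  move=> c0 cq; have : 0 < t ^+ 2 * (c + q) by rewrite mulr_gt0 ?exprn_gt0.
  have : 0 <= t * (1 - t) * c by rewrite !mulr_ge0 ?subr_ge0 // ltW.
  lra.
have [l0|l0] := leP 0 l.
  exists (x + t *: (p - x)).
    by apply: rU; rewrite /ball /= sub0r normrN gtr0_norm.
  by rewrite E fx add0r pos // -fpE.
exists (x + (- t) *: (p - x)).
  by apply: rU; rewrite /ball /= sub0r opprK gtr0_norm.
by rewrite E fx add0r sqrrN mulNr -mulrN pos //; lra.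
Qed.

(** Both signs of [f] occur in a ball around [x] and survive small [e]; a segment inside the ball
    then contains a zero. *)
Lemma quadratic_zero_persists (R : realType) (V : normedModType R)
    (f k : V -> R) (x p p' : V) (U : set V) :
  quadratic f -> quadratic k -> f x = 0 -> 0 < f p -> f p' < 0 -> nbhs x U ->
  \forall e \near (0 : R), exists2 z, U z & f z + e * k z = 0.
Proof.
move=> qf qk fx fp fp' /nbhs_ballP[r /= r0 rU].
have [z zr fz] := quadratic_pos_near qf fx fp (nbhsx_ballx x r r0).
(* The function [- f], in the shape that [quadratic_lin_comb] handles. *)
have [z' zr' fz'] : exists2 z, ball x r z & 0 < -1 * f z + 0 * f z.
  apply: (@quadratic_pos_near _ _ (fun z => -1 * f z + 0 * f z) x p').
  - exact: quadratic_lin_comb.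
  - by rewrite fx; ring.
  - by lra.
  - exact: nbhsx_ballx.
have lin_cvg (v : V) : (fun e : R => f v + e * k v) @ (0 : R) --> f v + 0 * k v.
  by apply: cvgD; [exact: cvg_cst|apply: cvgM; [exact: cvg_id|exact: cvg_cst]].
have nz : \forall e \near (0 : R), 0 < f z + e * k z.
  by apply: cvgr_gt (lin_cvg z) _ _; lra.
have nz' : \forall e \near (0 : R), f z' + e * k z' < 0.
  by apply: cvgr_lt (lin_cvg z') _ _; lra.
near=> e.
have [||t t01 ht] := @quadratic_root_between _ _
  (fun v => 1 * f v + e * k v) z z' (quadratic_lin_comb 1 e qf qk).
- by rewrite mul1r; near: e.
- by rewrite mul1r; near: e.
exists (z + t *: (z' - z)); last by rewrite -[RHS]ht mul1r.
apply: rU; move: zr zr' t01; rewrite -!ball_normE /= => zr zr' /andP[t0 t1].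
have -> : x - (z + t *: (z' - z)) = (1 - t) *: (x - z) + t *: (x - z').
  rewrite scalerBl scale1r -addrA -scalerN -scalerDr (opprB x z) subrKA.
  by rewrite opprD addrA -scalerN opprB.
apply: (le_lt_trans (ler_normD _ _)); rewrite !normrZ.
rewrite !ger0_norm ?subr_ge0 //.
have [->|t_neq0] := eqVneq t 0; first by rewrite subr0 mul1r mul0r addr0.
have tp : 0 < t by rewrite lt_neqAle eq_sym t_neq0.
have : t * `|x - z'| < t * r by rewrite ltr_pM2l.
have : (1 - t) * `|x - z| <= (1 - t) * r by rewrite ler_wpM2l ?subr_ge0 // ltW.
lra.
Unshelve. all: by end_near. Qed.

(** * Directions and rays in the plane *)

Definition inner (R : realType) (d v : R * R) : R := d.1 * v.1 + d.2 * v.2.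

(** The quarter turn: [inner (turn d) v] is the determinant of [d] and [v], positive to the left of
    [d]. *)
Definition turn (R : realType) (d : R * R) : R * R := (- d.2, d.1).

Definition on_ray (R : realType) (d v : R * R) :=
  inner (turn d) v = 0 /\ 0 < inner d v.

(* The image under G of some segment runs from the open ray of d to the open
   ray of - d on the left of the origin, as seen in the direction d. *)
Definition passes_left (R : realType) (V : lmodType R) (G : V -> R * R)
    (d : R * R) :=
  exists x y, [/\ on_ray d (G x), on_ray (- d) (G y) &
                  0 < inner (turn d) (G (midpoint x y))].

Lemma innerNl (R : realType) (d v : R * R) : inner (- d) v = - inner d v.
Proof. by rewrite /inner /=; ring. Qed.

Lemma turnN (R : realType) (d : R * R) : turn (- d) = - turn d.
Proof. by []. Qed.

Lemma turnK (R : realType) (d : R * R) : turn (turn d) = - d.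
Proof. by []. Qed.

Lemma on_rayN (R : realType) (d v : R * R) :
  on_ray (- d) v <-> inner (turn d) v = 0 /\ inner d v < 0.
Proof.
by rewrite /on_ray turnN !innerNl oppr_gt0; split=> -[H ?]; split=> //;
  move: H; lra.
Qed.

Lemma inner_gt0 (R : realType) (d : R * R) : d != 0 -> 0 < inner d d.
Proof.
case: d => d1 d2; rewrite /inner /= -!expr2 => d0.
rewrite lt_neqAle addr_ge0 ?sqr_ge0 // andbT eq_sym.
rewrite paddr_eq0 ?sqr_ge0 // !sqrf_eq0.
by apply: contra d0 => /andP[/eqP -> /eqP ->].
Qed.

(** This is Lagrange's identity. *)
Lemma inner_turn_eq0 (R : realType) (d v : R * R) :
  d != 0 -> v != 0 -> inner (turn d) v = 0 -> inner d v != 0.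
Proof.
move=> d0 v0 rdv; apply/eqP => dv; have vv := inner_gt0 v0.
have : inner d d * inner v v = inner d v ^+ 2 + inner (turn d) v ^+ 2.
  by rewrite /inner /turn /=; ring.
rewrite rdv dv expr0n addr0 => /eqP; rewrite mulf_eq0.
by rewrite !gt_eqF ?inner_gt0.
Qed.

(** Lets a fixed [d] test the orientation of points on the line of a perturbed direction [e]. *)
Lemma on_ray_of_inner (R : realType) (d e v : R * R) :
  inner (turn e) v = 0 -> 0 < inner d e -> 0 < inner d v -> on_ray e v.
Proof.
move=> ev de dv; split=> //.
have : inner e e * inner d v =
    inner e v * inner d e + inner (turn e) v * inner (turn e) d.
  by rewrite /inner /turn /=; ring.
rewrite ev mul0r addr0 => E; rewrite -(pmulr_lgt0 _ de) -E mulr_gt0 //.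
apply: inner_gt0; apply: contraTneq de => ->.
by rewrite /inner !mulr0 addr0 ltxx.
Qed.

Lemma turn_neq0 (R : realType) (d : R * R) : d != 0 -> turn d != 0.
Proof.
case: d => d1 d2; apply: contra => /eqP[/eqP + ->].
by rewrite oppr_eq0 => /eqP ->.
Qed.

(** * The side on which image arcs pass the origin *)

(** Reversing a segment replaces [d] by [- d] and exchanges left and right. *)
Lemma passes_left_or_opp (R : realType) (V : lmodType R) (G : V -> R * R)
    (d : R * R) :
  (forall e, quadratic (fun x => inner e (G x))) -> (forall x, G x != 0) ->
  (forall e, e != 0 -> exists x, on_ray e (G x)) ->
  d != 0 -> passes_left G d \/ passes_left G (- d).
Proof.
move=> qG nG rG d0; have [x xd] := rG _ d0.
have [|y yd] := rG (- d); first by rewrite oppr_eq0.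
have [[fx hx] [fy hy]] := (xd, iffLR (on_rayN d (G y)) yd).
have nz v : inner (turn d) (G v) = 0 -> inner d (G v) != 0.
  exact: inner_turn_eq0.
have := quadratic_midpoint_neq0 (qG (turn d)) (qG d) nz fx fy hx hy.
rewrite neq_lt => /orP[m|m]; last by left; exists x, y.
right; exists y, x; split=> //; first by rewrite opprK.
by rewrite midpointC turnN innerNl oppr_gt0.
Qed.

(** The mixed segment from [x] to [y'] contradicts one of the two given segments, with which it
    shares an end. *)
Lemma passes_left_asym (R : realType) (V : lmodType R) (G : V -> R * R)
    (d : R * R) :
  (forall e, quadratic (fun x => inner e (G x))) -> (forall x, G x != 0) ->
  d != 0 -> passes_left G d -> ~ passes_left G (- d).
Proof.
move=> qG nG d0 [x [y [[fx hx] /on_rayN[fy hy] mxy]]] [y' [x' []]].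
rewrite opprK turnN innerNl oppr_gt0 midpointC => /on_rayN[fy' hy'].
move=> [fx' hx'] mxy'.
have nz v : inner (turn d) (G v) = 0 -> inner d (G v) != 0.
  exact: inner_turn_eq0.
have nzN v : inner (turn (- d)) (G v) = 0 -> inner (- d) (G v) != 0.
  by apply: inner_turn_eq0; rewrite ?oppr_eq0.
have := quadratic_midpoint_neq0 (qG (turn d)) (qG d) nz fx fy' hx hy'.
rewrite neq_lt => /orP[m|m].
  exact: (midpoint_sign_unique (qG (turn d)) (qG d) nz fx fy fy' hx hy hy').
apply: (@midpoint_sign_unique _ _ _ _ y' x' x (qG (turn (- d))) (qG (- d)) nzN);
  rewrite ?turnN ?innerNl ?fx ?fx' ?fy' ?oppr0 ?oppr_gt0 ?oppr_lt0 //.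
- by rewrite midpointC.
- by rewrite midpointC.
Qed.

Lemma passes_left_near (R : realType) (V : normedModType R) (G : V -> R * R)
    (d k : R * R) :
  (forall e, quadratic (fun x => inner e (G x))) ->
  (forall e, continuous (fun x => inner e (G x))) ->
  (forall e, e != 0 -> exists x, on_ray e (G x)) ->
  d != 0 -> passes_left G d ->
  \forall e \near (0 : R), passes_left G (d.1 + e * k.1, d.2 + e * k.2).
Proof.
move=> qG cG rG d0 [x [y [[fx hx] /on_rayN[fy hy] mxy]]].
have dE e v : inner (turn (d.1 + e * k.1, d.2 + e * k.2)) v
    = inner (turn d) v + e * inner (turn k) v.
  by rewrite /inner /turn /=; ring.
(* Points over the rays of [turn d] and [- turn d] give both signs of [inner (turn d) (G z)], as
   [quadratic_zero_persists] requires. *)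
have [p [_ fp]] : exists p, on_ray (turn d) (G p).
  exact/rG/turn_neq0.
have [p' [_]] : exists p, on_ray (- turn d) (G p).
  by apply: rG; rewrite oppr_eq0 turn_neq0.
rewrite innerNl oppr_gt0 => fp'.
(* Joint continuity in both ends and [e] keeps the midpoint on the left when all three move. *)
pose m (z : (V * V) * R) := inner (turn d) (G (midpoint z.1.1 z.1.2))
  + z.2 * inner (turn k) (G (midpoint z.1.1 z.1.2)).
have cm : m z @[z --> (x, y, 0 : R)] --> m (x, y, 0).
  have cmid : midpoint z.1.1 z.1.2 @[z --> (x, y, 0 : R)] --> midpoint x y.
    apply: cvgZ; first exact: cvg_cst.
    apply: cvgD; apply: (@cvg_comp _ _ _ (fun z : V * V * R => z.1)).
    - exact: cvg_fst.
    - exact: cvg_fst.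
    - exact: cvg_fst.
    - exact: cvg_snd.
  apply: cvgD; first exact: (cvg_comp _ _ cmid (cG (turn d) _)).
  apply: cvgM; first exact: cvg_snd.
  exact: (cvg_comp _ _ cmid (cG (turn k) _)).
have : \forall z \near (x, y, 0 : R), 0 < m z.
  by apply: cvgr_gt cm _ _; rewrite /m /= mul0r addr0.
case=> -[AB C] /= [[[A B] /= [nA nB] AB'] nC] sub.
have hx' : \forall z \near x, 0 < inner d (G z) by apply: cvgr_gt (cG d x) _ _.
have hy' : \forall z \near y, inner d (G z) < 0 by apply: cvgr_lt (cG d y) _ _.
have nx := quadratic_zero_persists (qG (turn d)) (qG (turn k)) fx fp fp'
  (filterI nA hx').
have ny := quadratic_zero_persists (qG (turn d)) (qG (turn k)) fy fp fp'
  (filterI nB hy').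
have de : \forall e \near (0 : R),
    0 < inner d (d.1 + e * k.1, d.2 + e * k.2).
  have cde : inner d d + e * inner d k @[e --> (0 : R)] -->
      inner d d + 0 * inner d k.
    apply: cvgD; first exact: cvg_cst.
    by apply: cvgM; [exact: cvg_id|exact: cvg_cst].
  have : \forall e \near (0 : R), 0 < inner d d + e * inner d k.
    by apply: cvgr_gt cde _ _; rewrite mul0r addr0 inner_gt0.
  by apply: filterS => e; congr (0 < _); rewrite /inner /=; ring.
near=> e.
have [x' [Ax' x'0] x'e] : exists2 z, (A z /\ 0 < inner d (G z)) &
    inner (turn d) (G z) + e * inner (turn k) (G z) = 0 by near: e; exact: nx.
have [y' [By' y'0] y'e] : exists2 z, (B z /\ inner d (G z) < 0) &
    inner (turn d) (G z) + e * inner (turn k) (G z) = 0 by near: e; exact: ny.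
have de0 : 0 < inner d (d.1 + e * k.1, d.2 + e * k.2) by near: e.
have Ce : C e by near: e; exact: nC.
exists x', y'; split.
- by apply: on_ray_of_inner de0 x'0; rewrite dE.
- apply: (@on_ray_of_inner _ (- d)).
  + by rewrite turnN innerNl dE y'e oppr0.
  + by move: de0; congr (0 < _); rewrite /inner /=; ring.
  + by rewrite innerNl oppr_gt0.
rewrite dE; apply: (sub (x', y', e)); split=> //.
by apply: AB'.
Unshelve. all: by end_near. Qed.

(** The line through [d] and [turn d] misses 0. Along it, passing left is an open condition, and so
    is its negation, which is passing left for the opposite direction; the line is connected. *)
Lemma passes_left_turn (R : realType) (V : normedModType R) (G : V -> R * R)
    (d : R * R) :
  (forall e, quadratic (fun x => inner e (G x))) ->
  (forall e, continuous (fun x => inner e (G x))) -> (forall x, G x != 0) ->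
  (forall e, e != 0 -> exists x, on_ray e (G x)) ->
  d != 0 -> passes_left G d -> passes_left G (turn d).
Proof.
move=> qG cG nG rG d0 dl.
pose k := turn d - d; pose D t : R * R := (d.1 + t * k.1, d.2 + t * k.2).
have DE t s : D (t + s) = ((D t).1 + s * k.1, (D t).2 + s * k.2).
  by rewrite /D /=; congr (_, _); ring.
have D0 t : D t != 0.
  apply: contraTneq (inner_gt0 d0) => Dt.
  have : inner (D t) (D t) = ((1 - t) ^+ 2 + t ^+ 2) * inner d d.
    by rewrite /D /k /inner /turn /=; ring.
  rewrite Dt {1}/inner !mulr0 addr0 => /esym/eqP; rewrite mulf_eq0.
  case/orP => [|/eqP -> //]; last by rewrite ltxx.
  rewrite paddr_eq0 ?sqr_ge0 // !sqrf_eq0 subr_eq0 => /andP[/eqP <-].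
  by rewrite oner_eq0.
pose B := [set t | passes_left G (D t)].
have BC : ~` B = [set t | passes_left G (- D t)].
  apply/seteqP; split=> t /= Bt.
    by case: (passes_left_or_opp qG nG rG (D0 t)).
  by move=> /(passes_left_asym qG nG (D0 t)).
have openB : open B.
  rewrite openE => t Bt; apply/(nbhs0P B t).
  apply: filterS (passes_left_near k qG cG rG (D0 t) Bt) => s.
  by rewrite /B /= DE.
have openBC : open (~` B).
  rewrite openE BC => t Bt; rewrite /interior; apply/(nbhs0P _ t).
  have NDt0 : - D t != 0 by rewrite oppr_eq0.
  apply: filterS (passes_left_near (- k) qG cG rG NDt0 Bt) => s.
  by rewrite /= DE; congr passes_left; congr (_, _) => /=; ring.
have : connected [set: R] by apply/connected_intervalP => x y _ _ z _.
move=> /(_ B) BT; have : B 1.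
rewrite BT //.
- by exists 0; rewrite /B /D /= !mul0r !addr0; case: (d) dl.
- by exists B => //; rewrite setTI.
- by exists B; rewrite ?setTI // -openC.
rewrite /B /D /k /=; congr passes_left.
by rewrite /turn; congr (_, _) => /=; ring.
Qed.

(** Two quarter turns carry passing left from [d] to [- d], against asymmetry, yet one of the two
    must hold. *)
Lemma ray_missed (R : realType) (V : normedModType R) (G : V -> R * R) :
  (forall e, quadratic (fun x => inner e (G x))) ->
  (forall e, continuous (fun x => inner e (G x))) -> (forall x, G x != 0) ->
  ~ (forall e, e != 0 -> exists x, on_ray e (G x)).
Proof.
move=> qG cG nG rG.
have no_left d : d != 0 -> ~ passes_left G d.
  move=> d0 dl; apply: (passes_left_asym qG nG d0 dl); rewrite -turnK.
  by do 2?[apply: passes_left_turn => //; try exact: turn_neq0].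
have d0 : ((1, 0) : R * R) != 0 by apply/eqP => -[/eqP]; rewrite oner_eq0.
have [] := passes_left_or_opp qG nG rG d0; apply: no_left => //.
by rewrite oppr_eq0.
Qed.

(** * Quadraticity and continuity of [quad] *)

Lemma dotpDl (R : realType) (n : nat) (u v w : 'cV[R]_n) :
  dotp (u + v) w = dotp u w + dotp v w.
Proof. by rewrite -big_split; apply: eq_bigr => i _; rewrite mxE mulrDl. Qed.

Lemma dotpZl (R : realType) (n : nat) (c : R) (u w : 'cV[R]_n) :
  dotp (c *: u) w = c * dotp u w.
Proof.
by rewrite /dotp mulr_sumr; apply: eq_bigr => i _; rewrite mxE mulrA.
Qed.

Lemma dotpC (R : realType) (n : nat) (u v : 'cV[R]_n) : dotp u v = dotp v u.
Proof. by apply: eq_bigr => i _; rewrite mulrC. Qed.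

Lemma quadratic_quad (R : realType) (n : nat) (A : 'M[R]_n) (a : 'cV[R]_n) :
  quadratic (quad A a).
Proof.
move=> x u w.
exists (dotp (A *m x) u + dotp (A *m u) x + dotp a u),
  (dotp (A *m x) w + dotp (A *m w) x + dotp a w), (dotp (A *m u) u),
  (dotp (A *m u) w + dotp (A *m w) u), (dotp (A *m w) w) => s t.
rewrite /quad !mulmxDr -!scalemxAr.
rewrite !dotpDl !dotpZl ![dotp _ (_ + _)]dotpC !dotpDl !dotpZl.
rewrite !(dotpC x) !(dotpC u (A *m _)) !(dotpC w (A *m _)) !(dotpC _ a).
by ring.
Qed.

Lemma continuous_dotp (R : realType) (n : nat) (f g : 'cV[R]_n -> 'cV[R]_n) :
  (forall i, continuous (fun x => f x i 0)) ->
  (forall i, continuous (fun x => g x i 0)) ->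
  continuous (fun x => dotp (f x) (g x)).
Proof.
move=> cf cg; apply: continuous_big => [|i _ x]; first exact: add_continuous.
exact: (cvgM (cf i x) (cg i x)).
Qed.

Lemma continuous_lin_comb (R : realType) (T : topologicalType) (f g : T -> R)
    (c d : R) :
  continuous f -> continuous g -> continuous (fun x => c * f x + d * g x).
Proof.
move=> cf cg x; apply: cvgD.
  exact: (cvgM (cvg_cst c) (cf x)).
exact: (cvgM (cvg_cst d) (cg x)).
Qed.

Lemma continuous_quad (R : realType) (n : nat) (A : 'M[R]_n) (a : 'cV[R]_n) :
  continuous (quad A a).
Proof.
have cid i : continuous (fun x : 'cV[R]_n => x i 0) by exact: coord_continuous.
have cAx i : continuous (fun x : 'cV[R]_n => (A *m x) i 0).
  under eq_fun do rewrite mxE.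
  apply: continuous_big => [|j _ y]; first exact: add_continuous.
  exact: (cvgM (cvg_cst (A i j)) (cid j y)).
have ca i : continuous (fun _ : 'cV[R]_n => a i 0) by exact: cst_continuous.
move=> x; rewrite /quad; apply: cvgD; first exact: nbhs_filter.
  exact: (@continuous_dotp _ _ (fun x => A *m x) id cAx cid x).
exact: (@continuous_dotp _ _ (fun=> a) id ca cid x).
Qed.

(** * From convexity of the sums to rays met by [G] *)

Theorem theorem4p14 (R : realType) (n : nat) (n_ge1 : (1 <= n)%N)
    (A B : 'M[R]_n) (A_sym : A^T = A) (B_sym : B^T = B) (a b : 'cV[R]_n) :
  let F := fun x : 'cV[R]_n => (quad A a x, quad B b x) : plane R in
  (forall d : plane R, d <> 0 -> convex_set (set_sum (range F) (ray d))) ->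
  convex_set (range F).
Proof.
move=> F cF p q l pF qF; set m := (X in X \in _).
apply/negPn/negP => mF.
pose G z : R * R := F z - m.
have GE e z : inner e (G z)
    = 1 * (e.1 * quad A a z + e.2 * quad B b z) + - 1 * inner e m.
  by rewrite /inner /G /=; ring.
apply: (@ray_missed R 'cV[R]_n G).
- move=> e; rewrite (funext (GE e)).
  apply: quadratic_lin_comb.
    by apply: quadratic_lin_comb; exact: quadratic_quad.
  by move=> x u w; exists 0, 0, 0, 0, 0 => s t; ring.
- move=> e; rewrite (funext (GE e)).
  apply: continuous_lin_comb; last exact: cst_continuous.
  by apply: continuous_lin_comb; exact: continuous_quad.
- move=> z; apply: contra mF; rewrite subr_eq0 => /eqP <-.
  by apply/mem_set; exists z.
move=> d d0; have Nd0 : (- d : plane R) <> 0.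
  by apply/eqP; rewrite oppr_eq0.
have subF u : u \in range F -> u \in set_sum (range F) (ray (- d)).
  move=> /set_mem uF; apply/mem_set; exists u => //; exists 0.
    by exists 0; rewrite /= ?scale0r.
  by rewrite addr0.
(* Convexity for [- d] writes [m] as [F z - s *: d], so [G z = s *: d]; here [s] is nonzero because
   [m] is not a value of [F]. *)
have /set_mem[_ [z _ <-] [_ [s s0 <-] E]] :=
  cF _ Nd0 p q l (subF _ pF) (subF _ qF).
have mE : m = F z + s *: (- d) by rewrite E.
have sp : 0 < s.
  rewrite lt_neqAle s0 andbT; apply: contraNneq mF => s_eq0.
  by rewrite mE -s_eq0 scale0r addr0; apply/mem_set; exists z.
exists z; have -> : G z = (s * d.1, s * d.2).
  by rewrite /G mE opprD addNKr -scalerN opprK.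
split; rewrite /inner /turn /=; first by ring.
by have := mulr_gt0 sp (inner_gt0 d0); rewrite /inner; lra.
Qed.
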